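(* For any non-zero polynomials $f(x),g(x)\in\mathbb{Z}[x]$ and for any of their common divisors $d(x)\in\mathbb{Z}[x]$, $$\left|\mathrm{res}\big(f(x)/d(x),g(x)/d(x)\big)\right|=\left|S_{f/d,\,g/d}\right|\le A_{f,g}.$$
   Context: $\mathrm{res}$ denotes the resultant, i.e. the determinant of the Sylvester matrix of the two polynomials; $S_{f/d,\,g/d}$ is the Sylvester matrix of $f(x)/d(x)$ and $g(x)/d(x)$, and $|S_{f/d,\,g/d}|$ denotes the absolute value of its determinant. For a polynomial $u(x)=u_0x^n+\cdots+u_n$, $\|u(x)\|=\sqrt{\sum_{i=0}^n u_i^2}$. With $n=\deg f(x)$, $m=\deg g(x)$, $N_f=2^{n-1}\|f(x)\|$ and $N_g=2^{m-1}\|g(x)\|$, $$A_{f,g}=\sqrt{(n+1)^m(m+1)^n}\cdot N_f^m N_g^n=2^{2nm-n-m}\sqrt{(n+1)^m(m+1)^n}\cdot\|f(x)\|^m\|g(x)\|^n .$$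
   Formalization: In N_f and N_g the factor 2^{n-1} (resp. 2^{m-1}) is taken to be 1 instead of 1/2 when f (resp. g) is constant; with 1/2 the claim fails, e.g. f=1, g=x, d=1 has resultant 1 but A_{f,g}=1/2. *)

(* Defs.v *)
From mathcomp Require Import all_boot all_order all_algebra zify.
Set Implicit Arguments.
Unset Strict Implicit.
Unset Printing Implicit Defensive.
Import Order.TTheory GRing.Theory Num.Theory.
Local Open Scope ring_scope.

(* The formal degree; 0 for the zero polynomial. *)
Definition deg (u : {poly int}) : nat := (size u).-1.

Definition norm2 (R : rcfType) (u : {poly int}) : R :=
  Num.sqrt (\sum_(i < size u) (u`_i)%:~R ^+ 2).

(* 2^(deg u - 1) * ||u||.  The exponent is max(deg u - 1, 0): for a constant   *)
(* u the factor is 1, not 1/2.  With 1/2 the resultant bound fails, e.g. for   *)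
(* f = 1, g = 'X, d = 1, where the resultant is 1 and the bound would be 1/2.  *)
Definition Nbound (R : rcfType) (u : {poly int}) : R :=
  2 ^+ (deg u).-1 * norm2 R u.

Definition Abound (R : rcfType) (f g : {poly int}) : R :=
  Num.sqrt (((deg f).+1 ^ deg g * (deg g).+1 ^ deg f)%N%:R)
  * Nbound R f ^+ deg g * Nbound R g ^+ deg f.

Lemma NboundE (R : rcfType) (u : {poly int}) :
  (0 < deg u)%N -> Nbound R u = 2 ^ ((deg u)%:Z - 1) * norm2 R u.
Proof.
by rewrite /Nbound; case: (deg u) => // n _; rewrite intS addrAC subrr add0r.
Qed.

(* The truncated subtraction on nat is harmless: 2nm - n - m >= 0 when both    *)
(* degrees are positive, and it truncates to 0 when one of them is 0.          *)
Lemma AboundE (R : rcfType) (f g : {poly int}) :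
  let n := deg f in let m := deg g in
  Abound R f g = 2 ^+ (2 * n * m - n - m)
    * Num.sqrt ((n.+1 ^ m * m.+1 ^ n)%N%:R) * norm2 R f ^+ m * norm2 R g ^+ n.
Proof.
move=> n m; rewrite /Abound /Nbound -/n -/m !exprMn -!exprM.
have -> : (2 * n * m - n - m = n.-1 * m + m.-1 * n)%N.
  by move: n m => [|n] [|m]; rewrite ?muln0 ?mul0n //=; lia.
rewrite exprD; set s := Num.sqrt _.
by rewrite !mulrA; congr (_ * _); rewrite mulrAC; congr (_ * _);
   rewrite [s * _]mulrC mulrAC.
Qed.

(* Main.v *)
Require Import Defs.
From mathcomp Require Import all_boot all_order perm all_algebra all_field.
From mathcomp Require Import ring zify.
Import Order.TTheory GRing.Theory Num.Theory.
Local Open Scope ring_scope.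

(** The determinant of a matrix is at most the product of the 1-norms of its
    rows ([det_le_prod_rows]). In the Sylvester matrix of [p] and [q] these rows
    are shifted copies of [p] ([deg q] times) and of [q] ([deg p] times), so it
    suffices to bound the 1-norm of a factor [p] of [f = p * d] by
    [sqrt (deg f + 1) * 2 ^ (deg f - 1) * ||f||] ([l1norm_factor_le_Nbound]).
    Hadamard's inequality, with 2-norms of rows, is not called for: the factors
    [sqrt (deg f + 1)] in the bound leave room for the 1-norm.

    The bound on factors is Mignotte's. Over the complex numbers, let [M u] be
    the Mahler measure of [u], that is, [|lead_coef u|] times the product of
    [max (1, |z|)] over the roots [z]. It is multiplicative, and [1 <= M d] since
    the leading coefficient of [d] is a nonzero integer, so [M p <= M f].
    Expanding [p] over its roots bounds its 1-norm by [2 ^ deg p * M p], and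
    Landau's inequality [M f <= ||f||] ([landau_inequality]) closes the chain.
    This gives the exponent [deg f - 1] as soon as [d] is not constant; the
    remaining case is immediate by Cauchy-Schwarz.

    The squared form of the bound on factors relates integers only. It is proved
    over the algebraic numbers, which contain the roots, and can then be read in
    any real closed field. *)

(** * The 1-norm and the squared 2-norm of the coefficient vector *)

Definition l1norm (K : numDomainType) (u : {poly K}) : K :=
  \sum_(i < size u) `|u`_i|.

Definition sqnorm (K : numDomainType) (u : {poly K}) : K :=
  \sum_(i < size u) `|u`_i| ^+ 2.

Lemma sum_coef_widen (K : numDomainType) (F : K -> K) (u : {poly K}) N :
  F 0 = 0 -> (size u <= N)%N ->
  \sum_(i < size u) F u`_i = \sum_(i < N) F u`_i.
Proof.
move=> F0 leuN; rewrite (big_ord_widen N (fun i => F u`_i)) // big_mkcond.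
apply: eq_bigr => i _; case: ltnP => // leui.
by rewrite (nth_default 0 leui) F0.
Qed.

Lemma l1norm_widen (K : numDomainType) (u : {poly K}) N :
  (size u <= N)%N -> l1norm K u = \sum_(i < N) `|u`_i|.
Proof. by apply: sum_coef_widen; rewrite normr0. Qed.

Lemma sqnorm_widen (K : numDomainType) (u : {poly K}) N :
  (size u <= N)%N -> sqnorm K u = \sum_(i < N) `|u`_i| ^+ 2.
Proof.
by apply: (sum_coef_widen K (fun x => `|x| ^+ 2)); rewrite normr0 expr0n.
Qed.

Lemma l1norm_ge0 (K : numDomainType) (u : {poly K}) : 0 <= l1norm K u.
Proof. by apply: sumr_ge0. Qed.

Lemma sqnorm_ge0 (K : numDomainType) (u : {poly K}) : 0 <= sqnorm K u.
Proof. by apply: sumr_ge0 => i _; rewrite exprn_ge0. Qed.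

Lemma lead_coef_le_sqnorm (K : numDomainType) (u : {poly K}) :
  `|lead_coef u| ^+ 2 <= sqnorm K u.
Proof.
have [->|nz_u] := eqVneq u 0.
  by rewrite lead_coef0 normr0 expr0n sqnorm_ge0.
rewrite lead_coefE; have: ((size u).-1 < size u)%N.
  by rewrite prednK // size_poly_gt0.
move=> lt_u; rewrite /sqnorm (bigD1 (Ordinal lt_u)) //= lerDl.
by apply: sumr_ge0 => i _; rewrite exprn_ge0.
Qed.

Lemma l1normD (K : numDomainType) (u v : {poly K}) :
  l1norm K (u + v) <= l1norm K u + l1norm K v.
Proof.
pose N := maxn (size u) (size v).
rewrite (l1norm_widen _ (u + v) N) ?size_polyD //.
rewrite (l1norm_widen _ u N) ?leq_maxl // (l1norm_widen _ v N) ?leq_maxr //.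
by rewrite -big_split; apply: ler_sum => i _; rewrite coefD ler_normD.
Qed.

Lemma l1normZ (K : numDomainType) (c : K) (u : {poly K}) :
  l1norm K (c *: u) = `|c| * l1norm K u.
Proof.
rewrite (l1norm_widen _ (c *: u) (size u)) ?size_scale_leq // mulr_sumr.
by apply: eq_bigr => i _; rewrite coefZ normrM.
Qed.

Lemma sqnormZ (K : numDomainType) (c : K) (u : {poly K}) :
  sqnorm K (c *: u) = `|c| ^+ 2 * sqnorm K u.
Proof.
rewrite (sqnorm_widen _ (c *: u) (size u)) ?size_scale_leq // mulr_sumr.
by apply: eq_bigr => i _; rewrite coefZ normrM exprMn.
Qed.

Lemma l1normC (K : numDomainType) (c : K) : l1norm K c%:P = `|c|.
Proof. by rewrite (l1norm_widen _ _ 1) ?size_polyC_leq1 // big_ord1 coefC. Qed.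

Lemma l1norm_mulX (K : numDomainType) (u : {poly K}) :
  l1norm K ('X * u) = l1norm K u.
Proof.
rewrite (l1norm_widen _ _ (size u).+1).
  rewrite big_ord_recl coefXM normr0 add0r.
  by apply: eq_bigr => i _; rewrite coefXM.
by rewrite (leq_trans (size_polyMleq _ _)) // size_polyX.
Qed.

Lemma l1norm_mulXn (K : numDomainType) (u : {poly K}) k :
  l1norm K ('X^k * u) = l1norm K u.
Proof.
elim: k => [|k IHk]; first by rewrite expr0 mul1r.
by rewrite exprS -mulrA l1norm_mulX.
Qed.

Lemma l1norm_XsubC_mul (K : numDomainType) (z : K) (u : {poly K}) :
  l1norm K (('X - z%:P) * u) <= (1 + `|z|) * l1norm K u.
Proof.
rewrite mulrBl -mulNr -polyCN mul_polyC mulrDl mul1r.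
by apply: (le_trans (l1normD _ _ _)); rewrite l1norm_mulX l1normZ normrN.
Qed.

Lemma l1norm_prod_XsubC (K : numDomainType) (c : K) (s : seq K) :
  l1norm K (c *: \prod_(z <- s) ('X - z%:P))
    <= `|c| * \prod_(z <- s) (1 + `|z|).
Proof.
rewrite l1normZ ler_wpM2l //; elim: s => [|z s IHs].
  by rewrite !big_nil l1normC normr1.
rewrite !big_cons (le_trans (l1norm_XsubC_mul _ _ _)) // ler_wpM2l //.
by rewrite addr_ge0.
Qed.

(** Cauchy-Schwarz against the all-ones vector, obtained by summing
    [2 x y <= x ^ 2 + y ^ 2] over all pairs of coefficients. *)
Lemma l1norm_sqr_le (K : numDomainType) (u : {poly K}) :
  l1norm K u ^+ 2 <= (size u)%:R * sqnorm K u.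
Proof.
have amgm (x y : K) : x \is Num.real -> y \is Num.real ->
    x * y *+ 2 <= x ^+ 2 + y ^+ 2.
  move=> xr yr; rewrite -subr_ge0.
  have -> : x ^+ 2 + y ^+ 2 - x * y *+ 2 = (x - y) ^+ 2 by ring.
  by rewrite real_exprn_even_ge0 // realB.
rewrite -(ler_pMn2r (n := 2)) // expr2 /l1norm mulr_suml -sumrMnl.
apply: (@le_trans _ _ (\sum_(i < size u)
    (`|u`_i| ^+ 2 *+ size u + sqnorm K u))); last first.
  by rewrite big_split /= sumrMnl sumr_const card_ord mulr2n mulr_natl.
apply: ler_sum => i _; rewrite mulr_sumr -sumrMnl.
have -> : `|u`_i| ^+ 2 *+ size u = \sum_(j < size u) `|u`_i| ^+ 2.
  by rewrite sumr_const card_ord.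
by rewrite -big_split; apply: ler_sum => j _; rewrite amgm ?normr_real.
Qed.

(** * Landau's inequality and Mignotte's bound *)

(** Multiplication by [X - z] and by its reflection [1 - z^* X] act on the
    unit circle by factors of equal modulus, hence have the same effect on the
    2-norm. On coefficients the difference of the two sums telescopes. *)
Lemma sqnorm_reflect (C : numClosedFieldType) (z : C) (h : {poly C}) :
  sqnorm C (('X - z%:P) * h) = sqnorm C ((1 - z^* *: 'X) * h).
Proof.
pose N := (size h).+1.
pose a i := if i is j.+1 then h`_j else 0.
have cX i : ('X * h)`_i = a i by rewrite coefXM; case: i.
rewrite (sqnorm_widen _ (('X - z%:P) * h) N); last first.
  by rewrite (leq_trans (size_polyMleq _ _)) // size_XsubC.
rewrite (sqnorm_widen _ ((1 - z^* *: 'X) * h) N); last first.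
  have : (size ((1 - z^* *: 'X)%R : {poly C}) <= 2)%N.
    rewrite (leq_trans (size_polyD _ _)) // geq_max size_poly1 /=.
    by rewrite size_polyN (leq_trans (size_scale_leq _ _)) // size_polyX.
  move=> sz2; apply: leq_trans (size_polyMleq _ _) _.
  by rewrite -[N]/((2 + size h).-1) -!subn1 leq_sub2r // leq_add2r.
apply/eqP; rewrite -subr_eq0 -sumrB; apply/eqP.
(* With a, b the coefficients of index i - 1 and i, this is
   |a - z b|^2 - |b - z^* a|^2 = (1 - |z|^2) (|a|^2 - |b|^2). *)
transitivity (\sum_(0 <= i < N)
   ((`|z| ^+ 2 - 1) * `|a i.+1| ^+ 2 - (`|z| ^+ 2 - 1) * `|a i| ^+ 2)).
  rewrite big_mkord; apply: eq_bigr => i _.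
  rewrite mulrBl mul_polyC mulrBl mul1r -scalerAl !coefB !coefZ cX /=.
  by rewrite !normCK !rmorphB !rmorphM /= conjCK; ring.
rewrite (telescope_sumr (fun i => (`|z| ^+ 2 - 1) * `|a i| ^+ 2)) // /a /N.
by rewrite nth_default // normr0 expr0n mulr0 subrr.
Qed.

(** The roots outside the closed unit disk are reflected into it, which moves
    their moduli into the leading coefficient. *)
Definition reflect_factor (C : numClosedFieldType) (z : C) : {poly C} :=
  if 1 < `|z| then 1 - z^* *: 'X else 'X - z%:P.

Lemma sqnorm_reflect_prod (C : numClosedFieldType) (s : seq C) (h : {poly C}) :
  sqnorm C (h * \prod_(z <- s) ('X - z%:P))
    = sqnorm C (h * \prod_(z <- s) reflect_factor C z).
Proof.
elim: s h => [|z s IHs] h; first by rewrite !big_nil.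
rewrite !big_cons [in LHS]mulrA IHs -mulrA mulrCA [in RHS]mulrCA.
rewrite /reflect_factor; case: ifP => // _.
by rewrite sqnorm_reflect.
Qed.

Lemma lead_reflect_factor (C : numClosedFieldType) (z : C) :
  `|lead_coef (reflect_factor C z)| = Num.max 1 `|z|.
Proof.
rewrite /reflect_factor maxElt; case: ifP => [z_gt1|_]; last first.
  by rewrite lead_coefXsubC normr1.
have nz_z : z != 0 by rewrite -normr_gt0 (lt_trans ltr01).
rewrite addrC lead_coefDl ?lead_coefN ?lead_coefZ ?lead_coefX.
  by rewrite normrN mulr1 norm_conjC.
by rewrite size_poly1 size_polyN size_scale ?size_polyX // conjC_eq0.
Qed.

(** The left-hand side is the square of the Mahler measure. After reflecting
    the roots of modulus above 1 it is the squared modulus of the leading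
    coefficient, while the 2-norm has not changed. *)
Lemma landau_inequality (C : numClosedFieldType) (c : C) (s : seq C) :
  (`|c| * \prod_(z <- s) Num.max 1 `|z|) ^+ 2
    <= sqnorm C (c *: \prod_(z <- s) ('X - z%:P)).
Proof.
rewrite -mul_polyC sqnorm_reflect_prod.
apply: le_trans (lead_coef_le_sqnorm _ _).
rewrite lead_coefM lead_coefC lead_coef_prod normrM normr_prod.
by under [in leRHS]eq_bigr do rewrite lead_reflect_factor.
Qed.

(** The Mahler measure separates the two norms: it is multiplicative, it is at
    least 1 for [d], at most the 2-norm of [p * d], and the 1-norm of [p] is at
    most [2 ^ deg p] times that of [p], because [1 + |z| <= 2 max (1, |z|)]. *)
Lemma l1norm_factor_le (C : numClosedFieldType) (p d : {poly C}) :
  p != 0 -> 1 <= `|lead_coef d| ->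
  l1norm C p ^+ 2 <= 4 ^+ (size p).-1 * sqnorm C (p * d).
Proof.
move=> nz_p d_ge1.
have [s Dp] := closed_field_poly_normal p.
have [t Dd] := closed_field_poly_normal d.
set c := lead_coef p in Dp; set e := lead_coef d in Dd d_ge1.
have nz_c : c != 0 by rewrite lead_coef_eq0.
have -> : (size p).-1 = size s by rewrite Dp size_scale // size_prod_XsubC.
have max_ge1 (z : C) : 1 <= Num.max 1 `|z|.
  by rewrite maxElt; case: ifP => // /ltW.
have max_gez (z : C) : `|z| <= Num.max 1 `|z|.
  by rewrite maxElt; case: real_ltP => //; rewrite normr_real.
have max_ge0 (z : C) : 0 <= Num.max 1 `|z| by apply: le_trans (max_ge1 z).
have -> : p * d = (c * e) *: \prod_(z <- s ++ t) ('X - z%:P).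
  by rewrite {1}Dp {1}Dd big_cat -scalerAl -scalerAr scalerA.
apply: le_trans (ler_wpM2l _ (landau_inequality _ _ _));
  last by rewrite exprn_ge0.
have -> : (4 : C) = 2 ^+ 2 by rewrite -natrX.
rewrite -exprM mulnC exprM -exprMn lerXn2r ?nnegrE ?l1norm_ge0 //.
  by rewrite !mulr_ge0 ?exprn_ge0 // prodr_ge0.
rewrite {1}Dp; apply: le_trans (l1norm_prod_XsubC _ _ _) _.
rewrite big_cat normrM mulrCA -mulrA ler_wpM2l //.
have le1 : \prod_(z <- s) (1 + `|z|)
    <= 2 ^+ size s * \prod_(z <- s) Num.max 1 `|z|.
  elim: s {Dp} => [|z s IHs]; first by rewrite !big_nil expr0 mulr1.
  rewrite !big_cons exprS mulrACA ler_pM ?addr_ge0 ?prodr_ge0 //.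
    by move=> i _; rewrite addr_ge0.
  by rewrite mulr_natl mulr2n lerD.
apply: le_trans le1 _; rewrite mulrCA ler_wpM2l ?exprn_ge0 //=.
rewrite mulrCA ler_peMr ?prodr_ge0 //.
have ge1 : 1 <= \prod_(z <- t) Num.max 1 `|z|.
  elim: t {Dd} => [|z t IHt]; first by rewrite big_nil.
  by rewrite big_cons mulr_ege1.
by rewrite mulr_ege1.
Qed.

(** * Descent to integer polynomials *)

Lemma l1norm_int (K : numDomainType) (u : {poly int}) :
  l1norm K (map_poly intr u) = (l1norm int u)%:~R.
Proof.
rewrite (l1norm_widen _ _ (size u)) ?size_poly // rmorph_sum /=.
by apply: eq_bigr => i _; rewrite coef_map /= intr_norm.
Qed.

Lemma sqnorm_int (K : numDomainType) (u : {poly int}) :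
  sqnorm K (map_poly intr u) = (sqnorm int u)%:~R.
Proof.
rewrite (sqnorm_widen _ _ (size u)) ?size_poly // rmorph_sum /=.
by apply: eq_bigr => i _; rewrite coef_map /= rmorphXn /= intr_norm.
Qed.

Lemma norm_int_ge1 (c : int) : c != 0 -> 1 <= `|c|.
Proof. by move=> nz_c; lia. Qed.

(** The exponent is [deg (p * d) - 1], one better than Mignotte's bound gives
    for an arbitrary factor. If [d] is not constant then [deg p] is smaller than
    [deg (p * d)] and the Mahler measure gives it; if [d] is constant then [p] is
    at most [p * d] coefficientwise and Cauchy-Schwarz alone suffices, at the cost
    of the factor [deg (p * d) + 1]. *)
Lemma l1norm_int_factor_le (p d : {poly int}) : p * d != 0 ->
  l1norm int p ^+ 2
    <= (deg (p * d)).+1%:R * (4 ^+ (deg (p * d)).-1 * sqnorm int (p * d)).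
Proof.
rewrite mulf_eq0 negb_or => /andP[nz_p nz_d]; set f := p * d.
have szf : size f = (size p + size d).-1 by rewrite size_mul.
have szp : (0 < size p)%N by rewrite size_poly_gt0.
have szd : (0 < size d)%N by rewrite size_poly_gt0.
have e4 n : (1 : int) <= 4 ^+ n by rewrite exprn_ege1.
have [d1|d_gt1] := leqP (size d) 1.
  have [c Dc] : {c | d = c%:P} by exists d`_0; rewrite [LHS]size1_polyC.
  have nz_c : c != 0 by move: nz_d; rewrite Dc polyC_eq0.
  have Ef : f = c *: p by rewrite /f Dc mulrC mul_polyC.
  have -> : (deg f).+1 = size p by rewrite /deg Ef size_scale // prednK.
  apply: le_trans (l1norm_sqr_le _ _) _; rewrite ler_wpM2l //.
  apply: (@le_trans _ _ (sqnorm int f)); last first.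
    by rewrite ler_peMl ?sqnorm_ge0.
  by rewrite Ef sqnormZ ler_peMl ?sqnorm_ge0 // exprn_ege1 // norm_int_ge1.
apply: (@le_trans _ _ (4 ^+ (size p).-1 * sqnorm int f)).
  have injC : injective (intr : int -> algC) by apply: intr_inj.
  have := l1norm_factor_le algC (map_poly intr p) (map_poly intr d).
  rewrite -rmorphM /= l1norm_int sqnorm_int !size_map_inj_poly //.
  rewrite lead_coef_map_inj // map_poly_eq0_id0 ?intr_eq0 ?lead_coef_eq0 //.
  rewrite -intr_norm (ler_int _ 1) norm_int_ge1 ?lead_coef_eq0 //.
  by move=> /(_ nz_p isT); rewrite -(ler_int algC) rmorphXn rmorphM rmorphXn.
apply: (@le_trans _ _ (4 ^+ (deg f).-1 * sqnorm int f)).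
  rewrite ler_wpM2r ?sqnorm_ge0 // ler_weXn2l //.
  by rewrite /deg szf; lia.
by rewrite ler_peMl ?mulr_ge0 ?sqnorm_ge0 ?exprn_ge0 // ler1n.
Qed.

(** * The determinant of a Sylvester matrix *)

(** Expanding the product of the row sums gives one term per map from rows to
    columns; the Leibniz formula only keeps those that are permutations. *)
Lemma det_le_prod_rows (K : numDomainType) n (A : 'M[K]_n) :
  `|\det A| <= \prod_i \sum_j `|A i j|.
Proof.
rewrite bigA_distr_bigA /=; apply: le_trans (ler_norm_sum _ _ _) _.
pose F (f : {ffun 'I_n -> 'I_n}) := \prod_i `|A i (f i)|.
pose h (s : 'S_n) : {ffun 'I_n -> 'I_n} := val s.
have hinj : injective h by apply: val_inj.
have -> : \sum_(s : 'S_n) `|(-1) ^+ s * \prod_i A i (s i)|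
    = \sum_(f in [set h s | s : 'S_n]) F f.
  rewrite big_imset /=; last exact: in2W.
  apply: eq_bigr => s _; rewrite normrM normr_sign mul1r normr_prod.
  by apply: eq_bigr => i _; rewrite /h pvalE.
rewrite [leRHS](bigID (mem [set h s | s : 'S_n])) /= lerDl.
by apply: sumr_ge0 => f _; apply: prodr_ge0.
Qed.

Lemma Sylvester_det_le (K : numDomainType) (p q : {poly K}) :
  `|\det (Sylvester_mx p q)|
    <= l1norm K p ^+ (size q).-1 * l1norm K q ^+ (size p).-1.
Proof.
have row_sum (u : {poly K}) k N : (k + size u <= N)%N ->
    \sum_(j < N) `|u`_(j - k) *+ (k <= j)%N| = l1norm K u.
  move=> leN; rewrite -(l1norm_mulXn _ u k) (l1norm_widen _ _ N).
    apply: eq_bigr => j _; rewrite coefXnM ltnNge if_neg.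
    by case: ifP => _; rewrite ?mulr1n ?mulr0n.
  by rewrite (leq_trans (size_polyMleq _ _)) // size_polyXn.
have dims a b k : (k < b.-1)%N -> (k + a <= b.-1 + a.-1)%N by lia.
apply: le_trans (det_le_prod_rows _ _ _) _.
rewrite big_split_ord /= -[X in _ ^+ X * _]card_ord -[X in _ * _ ^+ X]card_ord.
rewrite -!prodr_const ler_pM ?prodr_ge0 //.
- by move=> i _; apply: sumr_ge0.
- by move=> i _; apply: sumr_ge0.
- rewrite le_eqVlt; apply/orP; left; apply/eqP; apply: eq_bigr => k _.
  rewrite -[RHS](row_sum p k ((size q).-1 + (size p).-1)%N).
    apply: eq_bigr => j _; rewrite Sylvester_mxE.
    by rewrite -[lshift _ k]/(unsplit (inl k)) unsplitK.
  exact: dims.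
rewrite le_eqVlt; apply/orP; left; apply/eqP; apply: eq_bigr => k _.
rewrite -[RHS](row_sum q k ((size q).-1 + (size p).-1)%N).
  apply: eq_bigr => j _; rewrite Sylvester_mxE.
  by rewrite -[rshift _ k]/(unsplit (inr k)) unsplitK.
by rewrite [leqRHS]addnC; apply: dims.
Qed.

(** * The bound *)

Lemma norm2E (R : rcfType) (u : {poly int}) :
  norm2 R u = Num.sqrt (sqnorm int u)%:~R.
Proof.
rewrite /norm2 /sqnorm rmorph_sum; congr (Num.sqrt _).
by apply: eq_bigr => i _; rewrite /= rmorphXn /= intr_norm real_normK ?num_real.
Qed.

Lemma norm2_ge1 (R : rcfType) (u : {poly int}) : u != 0 -> 1 <= norm2 R u.
Proof.
move=> nz_u; rewrite norm2E -{1}sqrtr1 ler_wsqrtr // (ler_int _ 1).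
apply: le_trans (lead_coef_le_sqnorm _ _).
by rewrite exprn_ege1 // norm_int_ge1 // lead_coef_eq0.
Qed.

Lemma l1norm_factor_le_Nbound (R : rcfType) (p d : {poly int}) : p * d != 0 ->
  (l1norm int p)%:~R
    <= Num.sqrt (deg (p * d)).+1%:R * Nbound R (p * d).
Proof.
move=> nz_f; rewrite /Nbound norm2E; set f := p * d.
have le2 : (l1norm int p)%:~R ^+ 2
    <= (deg f).+1%:R * ((2 ^+ (deg f).-1) ^+ 2 * (sqnorm int f)%:~R) :> R.
  have -> : (2 ^+ (deg f).-1) ^+ 2 = 4 ^+ (deg f).-1 :> R.
    by rewrite -exprM mulnC exprM -natrX.
  have := l1norm_int_factor_le p d nz_f; rewrite -/f -(ler_int R).
  by rewrite rmorphXn /= !rmorphM /= rmorphXn /= !rmorph_nat.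
move/ler_wsqrtr: le2.
rewrite sqrtr_sqr ger0_norm ?ler0z ?l1norm_ge0 // sqrtrM ?ler0n //.
by rewrite sqrtrM ?exprn_ge0 // sqrtr_sqr ger0_norm ?exprn_ge0.
Qed.

(** Needed to raise the exponents: the Sylvester matrix has [deg q] rows of
    coefficients of [p], and [deg q] may be smaller than [deg (q * d)]. *)
Lemma sqrt_Nbound_ge1 (R : rcfType) (u : {poly int}) : u != 0 ->
  1 <= Num.sqrt (deg u).+1%:R * Nbound R u.
Proof.
move=> nz_u; rewrite mulr_ege1 //.
  by rewrite -{1}sqrtr1 ler_wsqrtr // ler1n.
by rewrite /Nbound mulr_ege1 ?norm2_ge1 // exprn_ege1 // ler1n.
Qed.

(** Attaches each factor [sqrt (deg u).+1] to its [Nbound u], so that the bound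
    becomes a product of powers of the 1-norm bounds for the two quotients. *)
Lemma AboundM (R : rcfType) (f g : {poly int}) :
  Abound R f g = (Num.sqrt (deg f).+1%:R * Nbound R f) ^+ deg g
               * (Num.sqrt (deg g).+1%:R * Nbound R g) ^+ deg f.
Proof.
have sqrtX (a : R) k : 0 <= a -> Num.sqrt (a ^+ k) = Num.sqrt a ^+ k.
  move=> a0; elim: k => [|k IHk]; first by rewrite !expr0 sqrtr1.
  by rewrite !exprS sqrtrM // IHk.
rewrite /Abound natrM sqrtrM ?ler0n // !natrX !sqrtX ?ler0n //.
by rewrite (exprMn (deg g)) (exprMn (deg f)) -mulrA mulrACA -!exprMn.
Qed.

(* Common divisors are taken in Z[x]; p and q are the exact quotients f / d and
   g / d. The library's %| and %/ on {poly int} are pseudo-division, i.e. they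
   only see divisibility over the rationals. *)
Theorem lemma6p1 (R : rcfType) (f g d p q : {poly int})
    (hf : f != 0) (hg : g != 0) (hp : f = p * d) (hq : g = q * d) :
  `|resultant p q| = `|\det (Sylvester_mx p q)| /\
  (`|\det (Sylvester_mx p q)|)%:~R <= Abound R f g.
Proof.
split=> //.
have deg_le (u v : {poly int}) : u * v != 0 -> ((size u).-1 <= deg (u * v))%N.
  move=> nz; move: (nz); rewrite mulf_eq0 negb_or => /andP[nz_u nz_v].
  rewrite /deg size_mul // (polySpred nz_v) addnS /= -!subn1.
  by rewrite leq_sub2r ?leq_addr.
have expr_le (x y : R) i j : 0 <= x <= y -> 1 <= y -> (i <= j)%N ->
    x ^+ i <= y ^+ j.
  move=> /andP[x0 xy] y1 lij; apply: (@le_trans _ _ (y ^+ i)).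
    by rewrite lerXn2r // nnegrE (le_trans x0).
  by rewrite ler_weXn2l.
rewrite AboundM.
have := Sylvester_det_le int p q.
rewrite -(ler_int R) rmorphM /= !rmorphXn /= => /le_trans; apply.
rewrite ler_pM ?exprn_ge0 ?ler0z ?l1norm_ge0 // expr_le ?ler0z ?l1norm_ge0 //=.
- by rewrite hp l1norm_factor_le_Nbound -?hp.
- by rewrite sqrt_Nbound_ge1.
- by rewrite hq deg_le -?hq.
- by rewrite hq l1norm_factor_le_Nbound -?hq.
- by rewrite sqrt_Nbound_ge1.
- by rewrite hp deg_le -?hp.
Qed.
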